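(* Let $\mathbf a,\mathbf b\in\mathbb{Z}\setminus\{-1,0,1\}$ and let $T:[0,1]^2\to[0,1]^2$, $T(x,y)=(T_1(x),T_2(y))$, where $$T_1(x)=\mathbf a x \bmod 1,\qquad T_2(y)=\begin{cases}\mathbf a y\bmod 1,& y\le 1/|\mathbf a|,\\ \mathbf a\mathbf b y\bmod 1,& y\ge 1/|\mathbf a|.\end{cases}$$ Let $\mu$ be Lebesgue measure on $[0,1]^2$, let $\tau>0$, $\Delta_n=\{(x,y)\in[0,1]^2:|x-y|<\tau/(2n)\}$ and $\Delta_n^{(1)}=\Delta_n\cap T^{-1}(\Delta_n^c)$. Then $$\lim_{n\to\infty}n\,\mu\big(\Delta_n^{(1)}\cap T^{-j}(\Delta_n)\big)=0\quad\text{for all } j\ge2,$$ and the extremal index is $$\theta=\frac{|\mathbf a|-1}{|\mathbf a|^2}+\frac{|\mathbf a|-1}{|\mathbf a|}.$$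
   Context: The measure $\mu$ is $T$-invariant. The extremal index is $\theta:=1-\sum_{k=0}^\infty p_k$, where $$p_k:=\lim_{n\to\infty}\frac{\mu\left(\Delta_n\cap T^{-1}\Delta_n^c\cap\cdots\cap T^{-k}\Delta_n^c\cap T^{-(k+1)}\Delta_n\right)}{\mu(\Delta_n)},\quad k\ge0$$ (part of the claim is that these limits exist). *)

(* Defs.v *)
From HB Require Import structures.
From mathcomp Require Import all_boot all_order all_algebra.
From mathcomp Require Import all_classical all_reals all_analysis.

Set Implicit Arguments.
Unset Strict Implicit.
Unset Printing Implicit Defensive.

Import Order.TTheory GRing.Theory Num.Theory.
Import numFieldNormedType.Exports.

Local Open Scope classical_set_scope.
Local Open Scope ring_scope.

Section ExtremalIndex.
Context {d : measure_display} {X : measurableType d} {R : realType}.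
Variables (mu : {measure set X -> \bar R}) (T : X -> X) (Delta : nat -> set X).

(* Points of [Delta n] whose first return to [Delta n] occurs at time
   exactly [k.+1]. *)
Definition first_return (k n : nat) : set X :=
  Delta n `&` \bigcap_(i in [set i | (1 <= i <= k)%N])
                (iter i T @^-1` (~` Delta n))
          `&` (iter k.+1 T @^-1` Delta n).

Definition return_ratio (k : nat) : R^nat :=
  fun n => fine (mu (first_return k n)) / fine (mu (Delta n)).

(* [limn] and the infinite sum are meaningful only when the corresponding
   [cvgn] statements hold. *)
Definition return_prob (k : nat) : R := limn (return_ratio k).

Definition extremal_index : R := 1 - limn (series return_prob).

End ExtremalIndex.

(* R * R with the product of the Borel sigma-algebras that
   [lebesgue_measure] is defined on. *)
Notation plane R := (measurableTypeR R * measurableTypeR R)%type.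

Section CoupledMap.
Context {R : realType}.

Definition mod1 (x : R) : R := x - (Num.floor x)%:~R.

Definition T1 (a : int) (x : R) : R := mod1 (a%:~R * x).

(* The two branches agree at [y = 1 / `|a|]: see [T2_right]. *)
Definition T2 (a b : int) (y : R) : R :=
  if y <= 1 / `|a%:~R| then mod1 (a%:~R * y) else mod1 (a%:~R * b%:~R * y).

Definition coupled_map (a b : int) (z : plane R) : plane R :=
  (T1 a z.1, T2 a b z.2).

Definition unit_square : set (plane R) := `[0, 1] `*` `[0, 1].

Lemma measurable_unit_square : measurable unit_square.
Proof. by apply: measurableX; exact: measurable_itv. Qed.

(* The state space [0, 1]^2 is realised inside the plane: the square carries
   the measure, contains [strip], and is mapped into itself by [coupled_map]
   (see [coupled_map_unit_square]), so complements and preimages may be taken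
   in the plane. *)
Definition square_lebesgue : {measure set (plane R) -> \bar R} :=
  mrestr ((@lebesgue_measure R) \x (@lebesgue_measure R))%E
    measurable_unit_square.

Definition strip (tau : R) (n : nat) : set (plane R) :=
  [set z | unit_square z /\ `|(z.1 : R) - z.2| < tau / (2 * n%:R)].

Lemma mod1_itv (x : R) : 0 <= mod1 x < 1.
Proof.
rewrite /mod1 subr_ge0 Num.Theory.floor_le /= ltrBlDl.
by have := Num.Theory.floorD1_gt x; rewrite intrD.
Qed.

Lemma coupled_map_unit_square (a b : int) (z : plane R) :
  unit_square (coupled_map a b z).
Proof.
have mod1_01 x : 0 <= mod1 x <= 1.
  by have /andP[x_ge0 x_lt1] := mod1_itv x; rewrite x_ge0 ltW.
by split; rewrite /= in_itv /= /T1 /T2 //; case: ifP.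
Qed.

Lemma mod1_int (m : int) : mod1 m%:~R = 0.
Proof. by rewrite /mod1 intrKfloor subrr. Qed.

Lemma T2_right (a b : int) (y : R) : a != 0 -> 1 / `|a%:~R| <= y ->
  T2 a b y = mod1 (a%:~R * b%:~R * y).
Proof.
move=> a0 y_ge; rewrite /T2; case: ifPn => // y_le.
have {y_le y_ge} -> : y = `|a%:~R|^-1.
  by apply/eqP; rewrite -div1r eq_le y_le.
have aV : a%:~R / `|a%:~R| = (Num.sg a)%:~R :> R.
  rewrite {1}(numEsg a) intrM intr_norm mulfK //.
  by rewrite normr_eq0 intr_eq0.
by rewrite mulrAC aV -intrM !mod1_int.
Qed.

End CoupledMap.

(* Main.v *)
Require Import Defs.
From mathcomp Require Import all_boot all_order all_algebra.
From mathcomp Require Import all_classical all_reals all_analysis.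
From mathcomp Require Import measurable_realfun.
From mathcomp Require Import ring lra zify.
Set Implicit Arguments.
Unset Strict Implicit.
Unset Printing Implicit Defensive.
Import Order.TTheory GRing.Theory Num.Theory.
Import numFieldNormedType.Exports.
Local Open Scope classical_set_scope.
Local Open Scope ring_scope.

(* Let e = tau / (2 n) be the half-width of the strip.  Modulo integers,
   T_1^j x = a^j x and T_2^j y = a^j b^m y, where m counts the visits of the
   orbit of y to the right branch.  A point of the strip that is back in it at
   time j with m > 0 therefore has a^j (1 - b^m) x within O(e) of an integer;
   together with |x - y| < e, this leaves finitely many squares of side O(e),
   of total area O(e^2), which is negligible against the area 2 e of the strip.
   If m = 0, a return at time j forces |x - y| < e / |a|^j, and then the point
   was already back at time 1 unless an integer separates a x from a y, again
   an event of area O(e^2).  So returns after time 1 do not count, and up to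
   O(e^2) the first returns at time 1 fill the band x <= 1 / |a|,
   |x - y| < e / |a|, of area 2 e / |a|^2: p_0 = 1 / |a|^2 and
   theta = 1 - 1 / |a|^2. *)

(** * Closeness to integers and reduction modulo 1 *)

Definition near_int {R : realType} (P : int) (r x : R) : Prop :=
  exists q : int, `|P%:~R * x - q%:~R| < r.

Lemma near_intM {R : realType} (N M : int) (r x : R) : M != 0 ->
  near_int N r x -> near_int (M * N) (`|M%:~R| * r) x.
Proof.
move=> M0 [q xq]; exists (M * q).
by rewrite !intrM -mulrA -mulrBr normrM ltr_pM2l // normr_gt0 intr_eq0.
Qed.

Lemma near_int_le {R : realType} (N : int) (r s x : R) : r <= s ->
  near_int N r x -> near_int N s x.
Proof. by move=> rs [q xq]; exists q; exact: lt_le_trans rs. Qed.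

Lemma mod1_subint {R : realType} (x : R) : exists q : int, mod1 x = x - q%:~R.
Proof. by exists (Num.floor x). Qed.

(** If the floors agree they cancel; otherwise the larger floor lies between [u] and [v]. *)
Lemma mod1_dist {R : realType} (u v : R) :
  `|mod1 u - mod1 v| = `|u - v| \/ exists q : int, `|u - q%:~R| <= `|u - v|.
Proof.
have [E|] := eqVneq (Num.floor u) (Num.floor v).
  by left; rewrite /mod1 E; congr (`| _ |); ring.
have := Num.Theory.floor_itv u; have := Num.Theory.floor_itv v.
rewrite !intrD => /andP[v1 v2] /andP[u1 u2].
rewrite neq_lt => /orP[lt|lt]; right.
- have : (Num.floor u)%:~R + 1 <= (Num.floor v)%:~R :> R.
    by rewrite -(intrD _ _ 1) ler_int lezD1.
  move=> h; exists (Num.floor v); rewrite (ler0_norm (_ : u - v <= 0)); last lra.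
  by rewrite ler_norml; apply/andP; split; lra.
- have : (Num.floor v)%:~R + 1 <= (Num.floor u)%:~R :> R.
    by rewrite -(intrD _ _ 1) ler_int lezD1.
  move=> h; exists (Num.floor u); rewrite (ger0_norm (_ : 0 <= u - v)); last lra.
  by rewrite ler_norml; apply/andP; split; lra.
Qed.

(** * Iterates of the two coordinate maps and resonances *)

Section Dynamics.
Context {R : realType} (a b : int).
Local Notation A := (`|a%:~R| : R).

Lemma iter_coupled_map (j : nat) (z : plane R) :
  iter j (coupled_map a b) z = (iter j (T1 a) z.1, iter j (T2 a b) z.2).
Proof. by elim: j => [|j /= ->]; case: z. Qed.

Lemma iter_T1 (j : nat) (x : R) :
  exists q : int, iter j (T1 a) x = (a ^+ j)%:~R * x - q%:~R.
Proof.
elim: j => [|j [q IH]]; first by exists 0; rewrite expr0 mul1r subr0.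
rewrite iterS IH /T1.
have [p ->] := mod1_subint (a%:~R * ((a ^+ j)%:~R * x - q%:~R)).
by exists (a * q + p); rewrite exprS intrD !intrM; ring.
Qed.

(* [m] counts the visits to the right branch before time [j]. *)
Lemma iter_T2 (j : nat) (y : R) :
  exists (m : nat) (q : int),
    [/\ iter j (T2 a b) y = (a ^+ j * b ^+ m)%:~R * y - q%:~R, (m <= j)%N &
        (0 < m)%N || (j == 0%N) || (y <= 1 / A)].
Proof.
elim: j => [|j [m [q [IH mj my]]]].
  by exists 0%N, 0; split => //=; rewrite !expr0 mulr1 mul1r subr0.
rewrite iterS IH /T2; set w := _ * y - _.
case: ifP => wA.
- have [p ->] := mod1_subint (a%:~R * w).
  exists m, (a * q + p); split; first by rewrite /w exprS intrD !intrM; ring.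
    exact: leqW.
  case/orP: my => [/orP[->//|/eqP j0]|->]; last by rewrite !orbT.
  (* At [j = 0] the iterate is [y] itself, so the branch test bounds [y]. *)
  move: IH wA; rewrite -/w => <-; rewrite j0 /= => ->; by rewrite orbT.
- have [p ->] := mod1_subint (a%:~R * b%:~R * w).
  exists m.+1, (a * b * q + p); split => //.
  by rewrite /w !exprS intrD !intrM; ring.
Qed.

(* A common multiple of [a] and of the slopes [a ^ j * (1 - b ^ m)]
   of the map [T_1^j - T_2^j] near the diagonal, [0 < m <= j]. *)
Definition resonance (j : nat) : int :=
  a ^+ j * \prod_(m < j) (1 - b ^+ m.+1).

(** The parenthesis bounds, in units of the strip half-width, how far a resonant
    [a ^ j * (1 - b ^ m) * x] is from an integer; the first factor pays for passing to the common
    multiple. *)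
Definition resonance_radius (j : nat) : R :=
  `|(resonance j)%:~R| * (1 + A ^+ j * `|b%:~R| ^+ j).

Hypotheses (ha : (1 < `|a|)%N) (hb : (1 < `|b|)%N).

Lemma slope_gt1 : 1 < A.
Proof. by rewrite -intr_norm -abszE ltr1z. Qed.

Lemma slope_b_gt1 : 1 < `|b%:~R| :> R.
Proof. by rewrite -intr_norm -abszE ltr1z. Qed.

Lemma onesub_expr_neq0 (m : nat) : 1 - b ^+ m.+1 != 0.
Proof.
rewrite subr_eq0; apply/eqP => /(congr1 (fun x => `|x|%N)).
rewrite abszX /= => /esym E.
by have := ltn_expl m.+1 hb; rewrite E.
Qed.

Lemma slope_neq0 : a != 0.
Proof. by rewrite -absz_gt0 (ltn_trans _ ha). Qed.

Lemma resonance_neq0 (j : nat) : resonance j != 0.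
Proof.
rewrite mulf_neq0 ?expf_neq0 ?slope_neq0 //.
by apply/prodf_neq0 => m _; exact: onesub_expr_neq0.
Qed.

Lemma resonance_dvd (j m : nat) : (m < j)%N ->
  exists2 M : int, M != 0 & resonance j = M * (a ^+ j * (1 - b ^+ m.+1)).
Proof.
move=> mj; have := resonance_neq0 j; rewrite /resonance (bigD1 (Ordinal mj)) //=.
set M := \prod_(_ < _ | _) _ => h; exists M; last by ring.
by move: h; rewrite !mulf_eq0 !negb_or => /andP[_ /andP[]].
Qed.

Lemma resonance_dvd_slope (j : nat) : (0 < j)%N ->
  exists2 M : int, M != 0 & resonance j = M * a.
Proof.
case: j => // j _; have := resonance_neq0 j.+1; rewrite /resonance exprSr.
set M := \prod_(_ < _) _ => h; exists (a ^+ j * M); last by ring.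
by move: h; rewrite -mulrA mulrCA mulf_eq0 negb_or => /andP[].
Qed.

Lemma int_norm_ge1 (M : int) : M != 0 -> 1 <= `|M%:~R| :> R.
Proof. by move=> M0; rewrite -intr_norm -abszE ler1z lez_nat absz_gt0. Qed.

(** Since [N] has norm at least 1, the radius may grow by the norm of [M * N] instead of [M]. It
    then depends on the product alone, so one radius serves every divisor of [resonance j]. *)
Lemma near_int_mul (N M : int) (r x : R) : 0 <= r -> N != 0 -> M != 0 ->
  near_int N r x -> near_int (M * N) (`|(M * N)%:~R| * r) x.
Proof.
move=> r0 N0 M0 /(near_intM M0); apply: near_int_le.
rewrite intrM normrM -mulrA ler_wpM2l // ler_peMl //.
exact: int_norm_ge1.
Qed.

Lemma radius_ge0 (j : nat) : 0 <= A ^+ j * `|b%:~R| ^+ j.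
Proof. by rewrite mulr_ge0 ?exprn_ge0. Qed.

(** Puts the exceptional events at the branch point, the sides of the square and the discontinuities
    of [mod1] into the same set as the resonances. *)
Lemma near_slope_resonance (j : nat) (e x : R) : (0 < j)%N -> 0 <= e ->
  near_int a (A * e) x -> near_int (resonance j) (resonance_radius j * e) x.
Proof.
move=> j0 e0; have [M M0 E] := resonance_dvd_slope j0.
have A1 := ltW slope_gt1; have b1 := ltW slope_b_gt1.
move=> /(near_int_mul (mulr_ge0 (normr_ge0 _) e0) slope_neq0 M0).
rewrite -E; apply: near_int_le.
rewrite /resonance_radius mulrA ler_wpM2r // ler_wpM2l //.
have : A <= A ^+ j * `|b%:~R| ^+ j.
  by rewrite -exprMn (le_trans (ler_peMr _ b1)) // ler_eXnr // mulr_ege1.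
by lra.
Qed.

Lemma resonance_radius_ge1 (j : nat) : 1 <= resonance_radius j.
Proof.
rewrite /resonance_radius -[leLHS]mulr1 ler_pM ?ler01 //.
  exact: int_norm_ge1 (resonance_neq0 j).
by rewrite lerDl radius_ge0.
Qed.

(** Both orbits are affine modulo integers. After a right branch their slopes differ, which makes
    [x] resonant; without one the slopes agree, and [e] is too small for a nonzero integer shift. *)
Lemma return_cases (j : nat) (e x y : R) : (0 < j)%N -> 0 < e ->
  (1 + A ^+ j) * e <= 1 -> `|x - y| < e ->
  `|iter j (T1 a) x - iter j (T2 a b) y| < e ->
  near_int (resonance j) (resonance_radius j * e) x \/
  A ^+ j * `|x - y| < e /\ y <= 1 / A.
Proof.
move=> j0 e0 e1 xy; have [q ->] := iter_T1 j x.
have [m [p [-> mj my]]] := iter_T2 j y.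
case: m mj my => [|m] mj my dxy.
- right; split; last by move: my; rewrite gtn_eqF.
  move: dxy; rewrite expr0 mulr1.
  have -> : (a ^+ j)%:~R * x - q%:~R - ((a ^+ j)%:~R * y - p%:~R) =
            (a ^+ j)%:~R * (x - y) - (q - p)%:~R by rewrite intrB; ring.
  have [->|qp] := eqVneq (q - p) 0.
    by rewrite subr0 normrM rmorphXn normrX.
  (* A nonzero [q - p] would give [1 <= |q - p| < A ^ j * e + e <= 1]. *)
  have h : A ^+ j * `|x - y| <= A ^+ j * e by rewrite ler_wpM2l ?exprn_ge0 // ltW.
  move=> dxy; exfalso.
  have := int_norm_ge1 qp.
  have := ler_normB ((a ^+ j)%:~R * (x - y))
                    ((a ^+ j)%:~R * (x - y) - (q - p)%:~R).
  rewrite subKr normrM rmorphXn normrX.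
  move: dxy; rewrite rmorphXn; lra.
- left; have [M M0 E] := resonance_dvd mj.
  have -> : resonance_radius j * e =
      `|(resonance j)%:~R| * ((1 + A ^+ j * `|b%:~R| ^+ j) * e).
    by rewrite mulrA.
  rewrite E; apply: near_int_mul => //.
  + by rewrite mulr_ge0 ?addr_ge0 ?radius_ge0 // ltW.
  + by rewrite mulf_neq0 ?onesub_expr_neq0 // expf_neq0 // slope_neq0.
  (* Replacing [y] by [x] in the difference of the two iterates costs [a ^ j * b ^ m.+1 * (x - y)],
     which is at most [A ^ j * |b| ^ j * e] in norm. *)
  exists (q - p).
  have -> : (a ^+ j * (1 - b ^+ m.+1))%:~R * x - (q - p)%:~R =
   ((a ^+ j)%:~R * x - q%:~R - ((a ^+ j * b ^+ m.+1)%:~R * y - p%:~R))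
     - (a ^+ j * b ^+ m.+1)%:~R * (x - y).
    by rewrite !intrM !intrB; ring.
  apply: le_lt_trans (ler_normB _ _) _.
  rewrite mulrDl mul1r ltr_leD // normrM.
  rewrite ler_pM ?normr_ge0 ?(ltW xy) // intrM normrM !rmorphXn !normrX.
  by rewrite ler_wpM2l ?exprn_ge0 // ler_weXn2l // ltW // slope_b_gt1.
Qed.

End Dynamics.

(** * Measurability of the map, the strips and the return sets *)

Section Measurability.
Context {R : realType}.

Lemma measurable_mod1 :
  measurable_fun setT (@mod1 R : measurableTypeR R -> measurableTypeR R).
Proof.
apply: measurable_funB; first exact: measurable_id.
apply: nondecreasing_measurable => // x y xy.
by rewrite ler_int Num.Theory.le_floor.
Qed.

Lemma measurable_T1 (a : int) :
  measurable_fun setT (T1 a : measurableTypeR R -> measurableTypeR R).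
Proof. exact: measurableT_comp measurable_mod1 (mulrl_measurable _). Qed.

Lemma measurable_T2 (a b : int) :
  measurable_fun setT (T2 a b : measurableTypeR R -> measurableTypeR R).
Proof.
apply: measurable_fun_ifT.
- by apply: measurable_fun_ler => //; exact: measurable_cst.
- exact: measurableT_comp measurable_mod1 (mulrl_measurable _).
- exact: measurableT_comp measurable_mod1 (mulrl_measurable _).
Qed.

Lemma measurable_coupled_map (a b : int) :
  measurable_fun setT (@coupled_map R a b).
Proof.
apply: measurable_fun_pair.
- exact: measurableT_comp (measurable_T1 a) measurable_fst.
- exact: measurableT_comp (measurable_T2 a b) measurable_snd.
Qed.

Lemma measurable_fun_iter d (X : measurableType d) (f : X -> X) (j : nat) :
  measurable_fun setT f -> measurable_fun setT (iter j f).
Proof.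
move=> mf; elim: j => [|j IH]; first exact: measurable_id.
exact: measurableT_comp mf IH.
Qed.

Lemma measurable_iter_preimage (a b : int) (j : nat) (S : set (plane R)) :
  measurable S -> measurable (iter j (coupled_map a b) @^-1` S).
Proof.
move=> mS; rewrite -[X in measurable X]setTI.
exact: (measurable_fun_iter j (measurable_coupled_map a b)).
Qed.

Lemma measurable_near_diagonal (r : R) :
  measurable [set z : plane R | `|(z.1 : R) - z.2| < r].
Proof.
have mf : measurable_fun setT (fun z : plane R => `|(z.1 : R) - z.2|).
  apply: measurableT_comp; first exact: normr_measurable.
  by apply: measurable_funB; [exact: measurable_fst|exact: measurable_snd].
rewrite (_ : [set _ | _] =
  setT `&` (fun z : plane R => `|(z.1 : R) - z.2|) @^-1` `]-oo, r[).
  by apply: mf => //; exact: measurable_itv.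
by apply/seteqP; split=> z; rewrite /= in_itv /=; [split|case].
Qed.

Lemma measurable_strip (tau : R) (n : nat) : measurable (strip tau n).
Proof.
rewrite (_ : strip _ _ =
  unit_square `&` [set z | `|(z.1 : R) - z.2| < tau / (2 * n%:R)]) //.
apply: measurableI; first exact: measurable_unit_square.
exact: measurable_near_diagonal.
Qed.

Lemma measurable_first_return (a b : int) (tau : R) (k n : nat) :
  measurable (first_return (coupled_map a b) (strip tau) k n).
Proof.
apply: measurableI; last first.
  by apply: (measurable_iter_preimage _ _ k.+1); exact: measurable_strip.
apply: measurableI; first exact: measurable_strip.
apply: bigcap_measurableType => i _.
by apply: measurable_iter_preimage; apply: measurableC; exact: measurable_strip.
Qed.

End Measurability.

(** * Areas of diagonal bands and of the exceptional squares *)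

Section Areas.
Context {R : realType}.
Local Notation leb := (@lebesgue_measure R).
Local Notation area := ((leb \x leb)%E : {measure set (plane R) -> \bar R}).

(** Model for the strip and its returns. With [z.2] not confined to the square, every nonempty
    vertical section is an interval of length [2 * r], so the area is exact. *)
Definition band (h r : R) : set (plane R) :=
  [set z | 0 <= z.1 <= h /\ `|(z.1 : R) - z.2| < r].

Lemma measurable_band (h r : R) : measurable (band h r).
Proof.
rewrite (_ : band h r =
  (`[0, h]%classic `*` setT) `&` [set z | `|(z.1 : R) - z.2| < r]).
  apply: measurableI; last exact: measurable_near_diagonal.
  by apply: measurableX => //; exact: measurable_itv.
by apply/seteqP; split=> z; rewrite /band /= in_itv /=; [case|case=> -[]].
Qed.

Lemma area_band (h r : R) : 0 <= h -> 0 <= r ->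
  area (band h r) = (2 * r * h)%:E.
Proof.
move=> h0 r0.
have leb_itv : leb `[0, h]%classic = h%:E.
  have [->|hn0] := eqVneq h 0; first by rewrite set_itv1 lebesgue_measure_set1.
  by rewrite lebesgue_measure_itv /= lte_fin lt_neqAle eq_sym hn0 h0 oppr0 adde0.
rewrite /= /product_measure1.
rewrite (eq_integral (fun x : measurableTypeR R =>
  (2 * r)%:E * (\1_(`[0, h]%classic : set R) x)%:E))%E.
  rewrite ge0_integralZl //; last first.
  - by rewrite lee_fin; lra.
  - apply: measurableT_comp; first exact: EFin_measurable.
    by apply: measurable_indic; exact: measurable_itv.
  rewrite integral_indic ?setIT //.
  by rewrite [X in (_ * X)%E]leb_itv -EFinM.
(* The section over [x] is [ball x r] if [x] is in [[0, h]], and empty otherwise. *)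
move=> x _ /=; rewrite xsectionE indicE.
have [xin|xout] := boolP (x \in _).
- rewrite (_ : _ @^-1` _ = ball x r) ?mule1.
    by rewrite lebesgue_measure_ball // mulr2n mulrDl mul1r.
  move: xin; rewrite inE /= in_itv /= => xin.
  by apply/seteqP; split=> y; rewrite /band /ball /= => // -[].
- rewrite (_ : _ @^-1` _ = set0) ?measure0 ?mule0 //.
  move: xout; rewrite notin_setE /= in_itv /= => xout.
  by apply/seteqP; split=> y //= [].
Qed.

Lemma area_unit_square : area (unit_square : set (plane R)) = 1%E.
Proof.
transitivity (leb `[0%R, 1%R]%classic * leb `[0%R, 1%R]%classic)%E.
  by apply: product_measure1E; exact: measurable_itv.
by rewrite lebesgue_measure_itv /= lte_fin ltr01 -EFinB subr0 mule1.
Qed.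

(** The centre is the diagonal point [q / P] with [q = i - |P|]; the range of [i] in the cover gives
    all [q] from [-|P|] to [|P|]. The radius [2 * r] leaves room for [z.2], which is within [r] of
    [z.1]. *)
Definition near_int_square (P : int) (r : R) (i : nat) : set (plane R) :=
  ball ((i%:R - `|P|%N%:R) / P%:~R : R) (2 * r) `*`
  ball ((i%:R - `|P|%N%:R) / P%:~R : R) (2 * r).

Definition near_int_cover (P : int) (r : R) : set (plane R) :=
  \big[setU/set0]_(i < (2 * `|P|).+1) near_int_square P r i.

Lemma measurable_near_int_square (P : int) (r : R) (i : nat) :
  measurable (near_int_square P r i).
Proof. by apply: measurableX; exact: measurable_ball. Qed.

Lemma measurable_near_int_cover (P : int) (r : R) :
  measurable (near_int_cover P r).
Proof.
by apply: bigsetU_measurable => i _; exact: measurable_near_int_square.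
Qed.

Lemma area_near_int_cover (P : int) (r : R) : 0 <= r ->
  (area (near_int_cover P r) <= ((2 * `|P|).+1%:R * (16 * r ^+ 2))%:E)%E.
Proof.
move=> r0.
apply: le_trans (Boole_inequality _ _) _.
  by move=> i _; exact: measurable_near_int_square.
rewrite (eq_bigr (fun=> (16 * r ^+ 2)%:E)).
  by rewrite sumEFin sumr_const card_ord lee_fin -[X in X <= _]mulr_natl.
move=> i _; have r20 : 0 <= 2 * r by lra.
set B : set R := ball ((i%:R - `|P|%N%:R) / P%:~R : R) (2 * r).
transitivity (leb B * leb B)%E.
  by apply: product_measure1E; exact: measurable_ball.
by rewrite !lebesgue_measure_ball // -EFinM; congr EFin; ring.
Qed.

Lemma near_int_coverP (P : int) (r : R) (z : plane R) :
  P != 0 -> r <= 1 -> 0 <= z.1 <= 1 -> `|(z.1 : R) - z.2| < r ->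
  near_int P r (z.1 : R) -> near_int_cover P r z.
Proof.
case: z => x y /= P0 r1 /andP[x0 x1] xy [q xq].
have r0 : 0 < r by exact: le_lt_trans xy.
have P1 : 1 <= `|P%:~R| :> R := int_norm_ge1 P0.
have Pn : P%:~R != 0 :> R by rewrite intr_eq0.
(* For [x] in [[0, 1]], [|q| < |P| + r <= |P| + 1]. *)
have qP : (`|q| <= `|P|).
  rewrite -ltzD1 -(ltr_int R) intrD !intr_norm.
  have := ler_normB (P%:~R * x) (P%:~R * x - q%:~R).
  rewrite subKr normrM (ger0_norm x0).
  have : `|P%:~R| * x <= `|P%:~R| :> R by rewrite ler_piMr.
  by lra.
have qi : (absz (q + `|P|))%:R = q%:~R + `|P|%N%:R :> R.
  have h : 0 <= q + `|P| by move: qP; rewrite ler_norml; lia.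
  by rewrite !natr_absz ger0_norm // intrD.
have ilt : (absz (q + `|P|)%R < (2 * `|P|).+1)%N.
  by move: qP; rewrite ler_norml; lia.
rewrite /near_int_cover -bigcup_mkord; exists (absz (q + `|P|)) => //=.
rewrite /near_int_square qi addrK.
(* Dividing by [P] does not increase the distance, as [P] has norm at least 1. *)
have d : `|q%:~R / P%:~R - x| < r.
  rewrite -(ltr_pM2l (lt_le_trans ltr01 P1)) -normrM mulrBr mulrC divfK //.
  rewrite distrC (lt_le_trans xq) // ler_peMl //; exact: ltW.
split; rewrite /ball /=; first by lra.
have := ler_normD (q%:~R / P%:~R - x) (x - y).
rewrite addrA subrK; lra.
Qed.

End Areas.

Lemma unit_squareP {R : realType} (x y : R) :
  unit_square (x, y) <-> 0 <= x <= 1 /\ 0 <= y <= 1.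
Proof. by rewrite /unit_square /setX /= !in_itv. Qed.

(** * Returns to a fixed strip, up to the exceptional squares *)

Section Returns.
Context {R : realType} (a b : int).
Hypotheses (ha : (1 < `|a|)%N) (hb : (1 < `|b|)%N).
Local Notation A := (`|a%:~R| : R).
Local Notation leb := (@lebesgue_measure R).
Local Notation area := ((leb \x leb)%E : {measure set (plane R) -> \bar R}).
Local Notation T := (coupled_map a b : plane R -> plane R).

(** The slope [a] sends the branch point [1 / A] to the integer [Num.sg a]. *)
Lemma near_branch_point (e x : R) :
  `|x - 1 / A| < e -> near_int a (A * e) x.
Proof.
move=> xe; exists (Num.sg a).
have A0 : 0 < A := lt_trans ltr01 (slope_gt1 ha).
rewrite (_ : a%:~R * x - _ = a%:~R * (x - 1 / A)).
  by rewrite normrM ltr_pM2l.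
rewrite mulrBr div1r; congr (_ - _).
by rewrite {2}(numEsg a) intrM intr_norm mulfK // gt_eqF.
Qed.

(** One of the integers 0 and 1 separates [x] from [y], hence is within [e] of [x]. *)
Lemma near_square_side (e x y : R) : 0 <= x <= 1 -> `|x - y| < e ->
  ~ (0 <= y <= 1) -> near_int a (A * e) x.
Proof.
move=> /andP[x0 x1]; rewrite ltr_norml => /andP[xy1 xy2] /negP.
rewrite negb_and -!ltNge => y01.
suff : near_int 1 e x by move/(near_intM (slope_neq0 ha)); rewrite mulr1.
case/orP: y01 => y01; [exists 0|exists 1]; rewrite mul1r ltr_norml;
  apply/andP; split; lra.
Qed.

Section FixedStrip.
Variables (tau : R) (n j : nat).
Hypothesis j0 : (0 < j)%N.
Local Notation e := (tau / (2 * n%:R)).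
Hypotheses (e0 : 0 < e) (e1 : (1 + A ^+ j) * e <= 1)
  (r1 : resonance_radius a b j * e <= 1).
Local Notation E :=
  (near_int_cover (resonance a b j) (resonance_radius a b j * e)
    : set (plane R)).

Lemma near_resonance_cover (z : plane R) : 0 <= z.1 <= 1 ->
  `|(z.1 : R) - z.2| < e ->
  near_int (resonance a b j) (resonance_radius a b j * e) (z.1 : R) -> E z.
Proof.
move=> z01 ze; apply: near_int_coverP => //; first exact: resonance_neq0.
by rewrite (lt_le_trans ze) // ler_peMl ?resonance_radius_ge1 // ltW.
Qed.

Lemma near_slope_cover (z : plane R) : 0 <= z.1 <= 1 ->
  `|(z.1 : R) - z.2| < e -> near_int a (A * e) (z.1 : R) -> E z.
Proof.
move=> z01 ze /(near_slope_resonance ha hb j0 (ltW e0)).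
exact: near_resonance_cover.
Qed.

Lemma strip_sub_band : strip tau n `<=` (band 1 e : set (plane R)).
Proof. by move=> [x y] [/unit_squareP[]]. Qed.

Lemma band_sub_strip : band 1 e `<=` strip tau n `|` E.
Proof.
move=> [x y] [/= x01 xy].
have [y01|/negP y01] := boolP (0 <= y <= 1); last first.
  by right; apply: near_slope_cover => //; exact: near_square_side xy y01.
by left; split=> //; apply/unit_squareP.
Qed.

(** A nonresonant return has [y <= 1 / A]; if [x] is beyond [1 / A], then [x] is within [e] of the
    branch point. *)
Lemma return_sub_band : j = 1%N ->
  strip tau n `&` T @^-1` strip tau n `<=` band (1 / A) (e / A) `|` E.
Proof.
move=> j1 [x y] [[/unit_squareP[x01 y01] /= xy] [_ /= dT]].
have A0 : 0 < A := lt_trans ltr01 (slope_gt1 ha).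
have dTj : `|iter j (T1 a) x - iter j (T2 a b) y| < e by rewrite j1.
have [near|[Axy yA]] := return_cases ha hb j0 e0 e1 xy dTj.
  by right; exact: near_resonance_cover.
rewrite j1 expr1 in Axy.
have [xA|Ax] := leP x (1 / A).
  left; split => /=; first by rewrite xA; case/andP: x01 => ->.
  by rewrite ltr_pdivlMr // mulrC.
right; apply: near_slope_cover => //; apply: near_branch_point => /=.
move: xy; rewrite !ltr_norml => /andP[]; move: Ax yA; move: (1 / A) => c *.
by apply/andP; split; lra.
Qed.

(** A point of the band fails to return only if [y] leaves the square, [y] crosses the branch point,
    or an integer separates [a * x] from [a * y]. Each puts [a * x] within [A * e] of an integer. *)
Lemma band_sub_return :
  band (1 / A) (e / A) `<=` (strip tau n `&` T @^-1` strip tau n) `|` E.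
Proof.
move=> [x y] [/= /andP[x0 xA] xyA].
have A1 := slope_gt1 ha : 1 < A.
have A0 : 0 < A := lt_trans ltr01 A1.
have Axy : A * `|x - y| < e by move: xyA; rewrite ltr_pdivlMr // mulrC.
have xy : `|x - y| < e by apply: le_lt_trans Axy; rewrite ler_peMl // ltW.
have x1 : x <= 1.
  by rewrite (le_trans xA) // div1r invf_le1 // ltW.
have x01 : 0 <= x <= 1 by rewrite x0.
have [y01|/negP y01] := boolP (0 <= y <= 1); last first.
  by right; apply: near_slope_cover => //; exact: near_square_side xy y01.
have [yA|Ay] := leP y (1 / A); last first.
  right; apply: near_slope_cover => //; apply: near_branch_point => /=.
  move: xy; rewrite !ltr_norml => /andP[]; move: Ay xA; move: (1 / A) => c *.
  by apply/andP; split; lra.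
have [E'|[q xq]] := mod1_dist (a%:~R * x) (a%:~R * y); last first.
  right; apply: near_slope_cover => //; exists q.
  rewrite (le_lt_trans xq) // -mulrBr normrM (lt_le_trans Axy) //.
  by rewrite ler_peMl // ltW.
left; split; first by split=> //; apply/unit_squareP.
split; first exact: coupled_map_unit_square.
by rewrite /= /T1 /T2 yA E' -mulrBr normrM.
Qed.

(** A nonresonant return at time [j] gives [A * |x - y| < e] on the left branch. As the point is not
    back at time 1, [mod1] must have cut between [a * x] and [a * y]. *)
Lemma late_return_sub :
  strip tau n `&` T @^-1` (~` strip tau n) `&` iter j T @^-1` strip tau n
    `<=` E.
Proof.
move=> [x y] [[[/unit_squareP[x01 y01] /= xy] nT]].
rewrite /preimage /= iter_coupled_map => -[_ /= dT].
have A1 := slope_gt1 ha : 1 < A.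
have [near|[Axy yA]] := return_cases ha hb j0 e0 e1 xy dT.
  by apply: near_resonance_cover.
have {}Axy : A * `|x - y| < e.
  apply: le_lt_trans Axy; rewrite ler_wpM2r //.
  by rewrite ler_eXnr // ltW.
have [E'|[q xq]] := mod1_dist (a%:~R * x) (a%:~R * y).
  case: nT; split; first exact: coupled_map_unit_square.
  by rewrite /= /T1 /T2 yA E' -mulrBr normrM.
apply: near_slope_cover => //; exists q.
rewrite (le_lt_trans xq) // -mulrBr normrM (lt_le_trans Axy) //.
by rewrite ler_peMl // ltW.
Qed.

End FixedStrip.

(** * From inclusions to measure estimates *)

Lemma square_lebesgueE (S : set (plane R)) :
  S `<=` unit_square -> square_lebesgue S = area S.
Proof. by move=> SU; rewrite /square_lebesgue /= /mrestr (setIidl SU). Qed.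

Lemma square_lebesgue_fin (S : set (plane R)) : measurable S ->
  square_lebesgue S \is a fin_num.
Proof.
move=> mS; rewrite ge0_fin_numE //.
apply: (@le_lt_trans _ _ 1%E); last exact: ltry.
rewrite -(area_unit_square (R:=R)) /square_lebesgue /= /mrestr.
apply: (le_measure area); rewrite ?inE //.
- by apply: measurableI => //; exact: measurable_unit_square.
- exact: measurable_unit_square.
Qed.

(** The symmetric difference of [S] and [M] lies in [E]. The model [M] may stick out of the square,
    so it is measured by [area]. *)
Lemma area_approx (S M E : set (plane R)) (m k : R) :
  measurable S -> measurable M -> measurable E -> S `<=` unit_square ->
  S `<=` M `|` E -> M `<=` S `|` E -> area M = m%:E -> (area E <= k%:E)%E ->
  `|fine (square_lebesgue S) - m| <= k.
Proof.
move=> mS mM mE SU SME MSE aM aE.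
have le_area (X Y : set (plane R)) : measurable X -> measurable Y ->
    X `<=` Y `|` E -> (area X <= area Y + k%:E)%E.
  move=> mX mY XY; apply: (@le_trans _ _ (area (Y `|` E))).
    by apply: (le_measure area); rewrite ?inE //; exact: measurableU.
  by apply: le_trans (measureU2 area mY mE) _; rewrite leeD2l.
have := le_area _ _ mS mM SME; have := le_area _ _ mM mS MSE.
have := square_lebesgue_fin mS; rewrite aM -(square_lebesgueE SU).
move=> /fineK <-; rewrite -!EFinD !lee_fin => h1 h2.
by rewrite ler_norml; apply/andP; split; lra.
Qed.

(** * Passage to the limit of thin strips *)

Section Limits.
Variables (tau : R) (htau : 0 < tau).
Local Notation e := (fun n : nat => tau / (2 * n%:R)).

Lemma width_cvg0 : e n @[n --> \oo] --> (0 : R).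
Proof.
have -> : e = (fun n => (tau / 2) * n%:R^-1).
  by apply/funext => n; rewrite invfM mulrA.
rewrite -(mulr0 (tau / 2)); apply: cvgMr.
apply/gtr0_cvgV0; last exact: cvgr_idn.
by near=> n; rewrite ltr0n; near: n; exact: nbhs_infty_gt.
Unshelve. all: by end_near. Qed.

(** Positivity is also only eventual: at [n = 0] the width is [tau / 0 = 0]. *)
Lemma width_small (c : R) : 0 <= c ->
  \forall n \near \oo, 0 < e n /\ c * e n <= 1.
Proof.
move=> c0; near=> n; split.
  rewrite divr_gt0 // mulr_gt0 // ltr0n; near: n; exact: nbhs_infty_gt.
(* The bound uses [c + 1] so that [c = 0] is allowed. *)
have h : e n < (c + 1)^-1.
  near: n; apply: cvgr_lt width_cvg0 _ _.
  by rewrite invr_gt0; lra.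
have c1 : 0 < c + 1 by lra.
apply: (@le_trans _ _ (c * (c + 1)^-1)); first by rewrite ler_wpM2l // ltW.
by rewrite ler_pdivrMr //; lra.
Unshelve. all: by end_near. Qed.

(** The cover has area [K * e ^ 2]; after division by [e], the error [K * e] tends to 0 and the
    ratio is squeezed to [m]. *)
Lemma area_density (S M : nat -> set (plane R)) (m : R) (j : nat) :
  (0 < j)%N -> (forall n, measurable (S n)) -> (forall n, measurable (M n)) ->
  (forall n, S n `<=` unit_square) ->
  (forall n, 0 < e n -> area (M n) = (m * e n)%:E) ->
  (forall n, 0 < e n -> (1 + A ^+ j) * e n <= 1 ->
    resonance_radius a b j * e n <= 1 ->
    let E := near_int_cover (resonance a b j) (resonance_radius a b j * e n) in
    S n `<=` M n `|` E /\ M n `<=` S n `|` E) ->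
  fine (square_lebesgue (S n)) / e n @[n --> \oo] --> m.
Proof.
move=> j0 mS mM SU aM SM.
set C := resonance_radius a b j : R.
have C0 : 0 <= C by rewrite (le_trans ler01) // resonance_radius_ge1.
pose K : R := (2 * `|resonance a b j|).+1%:R * (16 * C ^+ 2).
have key : \forall n \near \oo,
    m - K * e n <= fine (square_lebesgue (S n)) / e n <= m + K * e n.
  near=> n.
  have [e0 e1] : 0 < e n /\ (1 + A ^+ j) * e n <= 1.
    by near: n; apply: width_small; rewrite addr_ge0 // exprn_ge0.
  have [_ r1] : 0 < e n /\ C * e n <= 1 by near: n; exact: width_small.
  have [SME MSE] := SM n e0 e1 r1.
  have aE := area_near_int_cover (resonance a b j) (mulr_ge0 C0 (ltW e0)).
  have := area_approx (mS n) (mM n) (measurable_near_int_cover _ _) (SU n)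
    SME MSE (aM n e0) aE.
  rewrite -(ler_pM2r (_ : 0 < (e n)^-1)) ?invr_gt0 //.
  rewrite -{1}(gtr0_norm (_ : 0 < (e n)^-1)) ?invr_gt0 //.
  rewrite -normrM mulrBl mulfK ?gt_eqF //.
  have -> :
      (2 * `|resonance a b j|).+1%:R * (16 * (C * e n) ^+ 2) / e n = K * e n.
    by rewrite /K exprMn; move: (lt0r_neq0 e0); move: (e n) => w w0; field.
  by rewrite ler_norml => /andP[? ?]; apply/andP; split; lra.
apply: (squeeze_cvgr key).
- rewrite -[X in _ --> X]subr0 -(mulr0 K).
  by apply: cvgB; [exact: cvg_cst|apply: cvgMr; exact: width_cvg0].
- rewrite -[X in _ --> X]addr0 -(mulr0 K).
  by apply: cvgD; [exact: cvg_cst|apply: cvgMr; exact: width_cvg0].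
Unshelve. all: by end_near. Qed.

End Limits.
End Returns.

(** * Densities of the strip and of its return sets relative to the half-width *)

Section Densities.
Context {R : realType} (a b : int) (tau : R).
Hypotheses (ha : (1 < `|a|)%N) (hb : (1 < `|b|)%N) (htau : 0 < tau).
Local Notation A := (`|a%:~R| : R).
Local Notation T := (coupled_map a b : plane R -> plane R).
Local Notation e := (fun n : nat => tau / (2 * n%:R)).
Local Notation mu := (@square_lebesgue R).

Lemma strip_sub_square (n : nat) : strip tau n `<=` unit_square.
Proof. by move=> z []. Qed.

Lemma strip_density : fine (mu (strip tau n)) / e n @[n --> \oo] --> (2 : R).
Proof.
apply: (@area_density _ a b ha hb _ htau _ (fun n => band 1 (e n)) _ 1) => //.
- by move=> n; exact: measurable_strip.
- by move=> n; exact: measurable_band.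
- by move=> n; exact: strip_sub_square.
- by move=> n e0; rewrite area_band ?mulr1 // ltW.
move=> n e0 e1 r1; split; last exact: band_sub_strip.
by apply: subset_trans (@subsetUl _ _ _); exact: strip_sub_band.
Qed.

Lemma first_return0E (n : nat) :
  first_return T (strip tau) 0 n = strip tau n `&` T @^-1` strip tau n.
Proof.
rewrite /first_return (_ : [set i | _] = set0) ?bigcap_set0 ?setIT //.
by apply/seteqP; split=> i //= /andP[]; case: i.
Qed.

(** The model band has area [2 * (e / A) * (1 / A)]. *)
Lemma first_return0_density :
  fine (mu (first_return T (strip tau) 0 n)) / e n @[n --> \oo] --> 2 / A ^+ 2.
Proof.
have A0 : 0 < A := lt_trans ltr01 (slope_gt1 ha).
apply: (@area_density _ a b ha hb _ htau _
  (fun n => band (1 / A) (e n / A)) _ 1) => //.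
- by move=> n; exact: measurable_first_return.
- by move=> n; exact: measurable_band.
- by move=> n z [[/strip_sub_square]].
- move=> n e0; rewrite area_band ?(divr_ge0 ler01) ?(divr_ge0 (ltW e0)) ?ltW //.
  move: (tau / _) => w; congr (_%:E); field.
  by rewrite gt_eqF.
move=> n e0 e1 r1; rewrite first_return0E; split; first exact: return_sub_band.
exact: band_sub_return.
Qed.

(** The model is empty. Allowing any measurable subset covers both the sets of the first claim and
    the first returns after time 1. *)
Lemma late_return_density (j : nat) (S : nat -> set (plane R)) : (0 < j)%N ->
  (forall n, measurable (S n)) ->
  (forall n, S n `<=` strip tau n `&` T @^-1` (~` strip tau n)
                      `&` iter j T @^-1` strip tau n) ->
  fine (mu (S n)) / e n @[n --> \oo] --> (0 : R).
Proof.
move=> j0 mS subS.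
apply: (@area_density _ a b ha hb _ htau _ (fun=> set0) _ j) => //.
- by move=> n z /subS [[/strip_sub_square]].
- by move=> n e0; rewrite measure0 mul0r.
move=> n e0 e1 r1; split=> // z /subS Sz; right.
exact: (late_return_sub ha hb j0 e0 e1 r1).
Qed.

Lemma first_return_density (k : nat) :
  fine (mu (first_return T (strip tau) k.+1 n)) / e n @[n --> \oo] --> (0 : R).
Proof.
(* Index [k.+1] means first return at time [k.+2]; the constraint [i = 1] says that the point is out
   at time 1. *)
apply: (@late_return_density k.+2) => // n; first exact: measurable_first_return.
by move=> z [[? /(_ 1%N isT) ?] ?].
Qed.

(** Quotient of two densities; the common factor [e n] cancels once it is nonzero. *)
Lemma return_ratio_cvg (k : nat) (l : R) :
  fine (mu (first_return T (strip tau) k n)) / e n @[n --> \oo] --> l ->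
  return_ratio mu T (strip tau) k n @[n --> \oo] --> l / 2.
Proof.
move=> /cvgM /(_ (cvgV _ strip_density)) cv.
apply: cvg_trans (cv _); last by rewrite pnatr_eq0.
apply: near_eq_cvg; near=> n.
have [e0 _] : 0 < e n /\ 0 * e n <= 1 by near: n; exact: width_small.
have cancel (x y w : R) : w != 0 -> x / w / (y / w) = x / y.
  by move=> w0; rewrite invfM invrK mulrACA mulVf // mulr1.
by rewrite /return_ratio /= cancel // gt_eqF.
Unshelve. all: by end_near. Qed.

End Densities.

(** * Limits of the return ratios and value of the extremal index *)

Theorem proposition6p6 (R : realType) (a b : int)
    (ha : a \notin [:: -1; 0; 1]) (hb : b \notin [:: -1; 0; 1])
    (tau : R) (htau : 0 < tau) :
  let T : plane R -> plane R := coupled_map a b in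
  let mu := @square_lebesgue R in
  let Delta : nat -> set (plane R) := strip tau in
  let Delta1 : nat -> set (plane R) :=
    fun n => Delta n `&` (T @^-1` (~` Delta n)) in
  (forall j : nat, (2 <= j)%N ->
     n%:R%:E * mu (Delta1 n `&` (iter j T @^-1` Delta n)) @[n --> \oo]
       --> (0 : \bar R))%E /\
  (forall k : nat, cvgn (return_ratio mu T Delta k)) /\
  cvgn (series (return_prob mu T Delta)) /\
  extremal_index mu T Delta =
    (`|a%:~R| - 1) / `|a%:~R| ^+ 2 + (`|a%:~R| - 1) / `|a%:~R|.
Proof.
have {}ha : (1 < `|a|)%N by move: ha; rewrite !inE; lia.
have {}hb : (1 < `|b|)%N by move: hb; rewrite !inE; lia.
move=> T mu Delta Delta1.
have A1 := @slope_gt1 R a ha.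
have ratio0 := return_ratio_cvg ha hb htau (first_return0_density ha hb htau).
have ratioS k := return_ratio_cvg ha hb htau (first_return_density ha hb htau k).
have prob0 : return_prob mu T Delta 0 = 1 / `|a%:~R| ^+ 2.
  transitivity (2 / `|a%:~R| ^+ 2 / 2 : R); first exact: (cvg_lim _ ratio0).
  by field; rewrite gt_eqF // (lt_trans ltr01).
have probS k : return_prob mu T Delta k.+1 = 0.
  by rewrite -[RHS](mul0r 2^-1); exact: (cvg_lim _ (ratioS k)).
have ser : series (return_prob mu T Delta) n @[n --> \oo] -->
    (1 / `|a%:~R| ^+ 2 : R).
  (* The partial sum at 0 is empty; after a shift by one, all partial sums equal the term of index
     0. *)
  rewrite -cvg_shiftS; apply: cvg_near_cst; near=> n.
  rewrite [LHS](_ : _ = \sum_(0 <= i < n.+1) return_prob mu T Delta i) //.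
  rewrite big_nat_recl // prob0 big1 ?addr0 //.
split.
  move=> j j2.
  have mS n : measurable (Delta1 n `&` iter j T @^-1` Delta n).
    apply: measurableI; last first.
      by apply: measurable_iter_preimage; exact: measurable_strip.
    apply: measurableI; first exact: measurable_strip.
    apply: (measurable_iter_preimage _ _ 1); apply: measurableC.
    exact: measurable_strip.
  have cv := late_return_density ha hb htau (ltnW j2) mS
    (fun n => @subset_refl _ _).
  (* For [n > 0], [(tau / 2) / e n = n], which turns the density into [n] times the measure. *)
  have {}cv := cvgM cv (cvg_cst (tau / 2 : R)).
  rewrite mul0r in cv.
  apply: cvg_EFin.
    by near=> n; rewrite fin_numM // square_lebesgue_fin.
  apply: cvg_trans (cv _ _); apply: near_eq_cvg; near=> n.
  have n0 : n%:R != 0 :> R.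
    by rewrite pnatr_eq0 -lt0n; near: n; exact: nbhs_infty_gt.
  rewrite /comp fineM ?square_lebesgue_fin //=.
  by field; rewrite n0 gt_eqF.
split.
  case=> [|k]; apply/cvg_ex; first by exists (2 / `|a%:~R| ^+ 2 / 2).
  by exists (0 / 2).
split; first by apply/cvg_ex; exists (1 / `|a%:~R| ^+ 2).
(* Both sides equal [1 - 1 / A ^ 2], with [A] the norm of [a]. *)
rewrite /extremal_index (cvg_lim _ ser) //; field.
by rewrite gt_eqF // (lt_trans ltr01).
Unshelve. all: by end_near. Qed.
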